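(* Let $K\subset\mathbb{R}^n$ be a body and let $\mathcal{E}\subset\mathbb{R}^n$ be an ellipsoid. Then there exists a unique ellipsoid $\mathcal{F}_0\subset K$ such that $$M_{\mathcal{E}}(\mathcal{F}_0)=\inf\{M_{\mathcal{E}}(\mathcal{F})\ :\ \mathcal{F}\subset K \text{ an ellipsoid}\}.$$
   Context: A body in $\mathbb{R}^n$ is a compact convex set $K$ with $K=-K$ and non-empty interior; $\|x\|_K=\inf\{\lambda>0: x\in\lambda K\}$ is the norm with unit ball $K$. An ellipsoid means a centrally-symmetric (centered at the origin), non-degenerate ellipsoid, i.e. a set $\{\sum_{i=1}^n\lambda_i u_i : \sum_i\lambda_i^2\le 1\}$ with $u_1,\dots,u_n\in\mathbb{R}^n$ linearly independent. For an ellipsoid $\mathcal{E}$, $\langle\cdot,\cdot\rangle_{\mathcal{E}}$ is the unique scalar product on $\mathbb{R}^n$ with $\mathcal{E}=\{x:\langle x,x\rangle_{\mathcal{E}}\le 1\}$, and $\mu_{\mathcal{E}}$ is the unique Borel probability measure on $\partial\mathcal{E}$ invariant under all linear isometries of $(\mathbb{R}^n,\langle\cdot,\cdot\rangle_{\mathcal{E}})$. For a body $K$, $M_{\mathcal{E}}(K)=\left(\int_{\partial\mathcal{E}}\|x\|_K^2\,d\mu_{\mathcal{E}}(x)\right)^{1/2}$. *)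

(* Defs.v *)
From HB Require Import structures.
From mathcomp Require Import all_boot all_order all_algebra.
From mathcomp Require Import all_classical all_reals all_analysis.

Set Implicit Arguments.
Unset Strict Implicit.
Unset Printing Implicit Defensive.

Import Order.TTheory GRing.Theory Num.Theory.
Import numFieldNormedType.Exports.

Local Open Scope classical_set_scope.
Local Open Scope ring_scope.

(* R^n is the space of row vectors 'rV[R]_n, with its library topology. *)

Definition body (R : realType) (n : nat) (K : set 'rV[R]_n) : Prop :=
  [/\ compact K, convex_set K, K = [set - x | x in K] & interior K !=set0].

Definition body_norm (R : realType) (n : nat) (K : set 'rV[R]_n)
    (x : 'rV[R]_n) : R :=
  inf [set l : R | 0 < l /\ [set l *: y | y in K] x].

Definition ellipsoid (R : realType) (n : nat) (E : set 'rV[R]_n) : Prop :=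
  exists2 u : n.-tuple 'rV[R]_n, free u &
    E = [set \sum_(i < n) l i *: tnth u i
        | l in [set l : 'I_n -> R | \sum_(i < n) l i ^+ 2 <= 1]].

Definition boundary (T : topologicalType) (A : set T) : set T :=
  closure A `\` interior A.

(* R^n equipped with its Borel sigma-algebra. *)
Notation borelRV R n := (g_sigma_algebraType (@open 'rV[R]_n)).

(* For an ellipsoid E this determines the scalar product s uniquely. *)
Definition scalar_product_of (R : realType) (n : nat) (E : set 'rV[R]_n)
    (s : {dot 'rV[R]_n for idfun}) : Prop :=
  E = [set x | s x x <= 1].

(* Borel probability measures on the boundary of E are taken to be the Borel
   probability measures on R^n that give it full mass; invariance is invariance
   under push-forward.  When s is the scalar product of the ellipsoid E, this
   determines mu uniquely. *)
Definition invariant_probability (R : realType) (n : nat) (E : set 'rV[R]_n)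
    (s : {dot 'rV[R]_n for idfun}) (mu : probability (borelRV R n) R) : Prop :=
  mu (boundary E) = 1%E /\
  forall T : {linear 'rV[R]_n -> 'rV[R]_n},
    isometry s s T ->
    forall A : set (borelRV R n), measurable A -> mu (T @^-1` A) = mu A.

Definition M_ (R : realType) (n : nat) (E : set 'rV[R]_n)
    (mu : probability (borelRV R n) R) (K : set 'rV[R]_n) : R :=
  Num.sqrt (\int[mu]_(x in boundary E) (body_norm K x ^+ 2)).

(* Main.v *)
Require Import Defs.
From HB Require Import structures.
From mathcomp Require Import all_boot all_order all_algebra.
From mathcomp Require Import all_classical all_reals all_analysis.
From mathcomp Require Import measurable_realfun.
From mathcomp Require Import ring lra.

Set Implicit Arguments.
Unset Strict Implicit.
Unset Printing Implicit Defensive.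

Import Order.TTheory GRing.Theory Num.Theory.
Import numFieldNormedType.Exports.

Local Open Scope classical_set_scope.
Local Open Scope ring_scope.

(**
  An ellipsoid is written [ell W], the unit ball of the quadratic form
  [q_W x = sqn (x *m W)], with [W] invertible; in particular [E = ell A].  The
  invariance of [mu] under reflections makes its second-moment matrix in the
  coordinates [x *m A] equal to [1 / n], so that [M_E(ell W)^2] is the squared
  Frobenius norm of [A^-1 W] divided by [n], i.e. the mean of [q_W] over an
  orthonormal basis of [E].

  Existence: [ell W] is contained in the closed set [K] iff [q_W >= 1] outside
  [K].  This is a closed condition on [W], and, [K] being bounded, it forces [W]
  to be invertible.  Since moreover a bound on the Frobenius norm cuts out a
  bounded set, a minimizer exists by compactness.

  Uniqueness: if [G1] and [G2] are the Gram matrices of two minimizers, the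
  ellipsoid of the form [G = ((G1^-1 + G2^-1) / 2)^-1] still lies in [K] by
  convexity, and [G <= (G1 + G2) / 2], with equality at a vector [x] only if
  [x G1 = x G2].  Minimality forces equality on an orthonormal basis of [E],
  hence [G1 = G2].
*)

(** * Dot product and squared length of row vectors *)

Definition rdot (R : pzRingType) n (x y : 'rV[R]_n) : R := (x *m y^T) 0 0.

Definition sqn (R : pzRingType) n (x : 'rV[R]_n) : R := rdot x x.

Section RowDot.
Context {R : comPzRingType} {n : nat}.
Implicit Types (x y z : 'rV[R]_n) (c : R).

Lemma rdotE x y : rdot x y = \sum_i x 0 i * y 0 i.
Proof. by rewrite /rdot mxE; apply: eq_bigr => i _; rewrite mxE. Qed.

Lemma rdotC x y : rdot x y = rdot y x.
Proof. by rewrite !rdotE; apply: eq_bigr => i _; rewrite mulrC. Qed.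

Lemma rdotDl x y z : rdot (x + y) z = rdot x z + rdot y z.
Proof. by rewrite /rdot mulmxDl mxE. Qed.

Lemma rdotZl c x y : rdot (c *: x) y = c * rdot x y.
Proof. by rewrite /rdot -scalemxAl mxE. Qed.

Lemma rdotMl m (x : 'rV[R]_n) (M : 'M[R]_(n, m)) (y : 'rV_m) :
  rdot (x *m M) y = rdot x (y *m M^T).
Proof. by rewrite /rdot trmx_mul trmxK mulmxA. Qed.

Lemma sqnE x : sqn x = \sum_i x 0 i ^+ 2.
Proof. by rewrite /sqn rdotE; apply: eq_bigr => i _; rewrite expr2. Qed.

Lemma sqnZ c x : sqn (c *: x) = c ^+ 2 * sqn x.
Proof. by rewrite /sqn rdotZl rdotC rdotZl mulrA expr2. Qed.

Lemma sqnB x y : sqn (x - y) = sqn x - rdot x y *+ 2 + sqn y.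
Proof.
rewrite -scaleN1r /sqn rdotDl rdotZl !(rdotC _ (_ + _)) !rdotDl !rdotZl.
by rewrite (rdotC y x) mulr2n; ring.
Qed.

Lemma sqn0 : sqn (0 : 'rV[R]_n) = 0.
Proof. by rewrite /sqn /rdot mul0mx mxE. Qed.

End RowDot.

Section RowDotReal.
Context {R : realDomainType} {n : nat}.
Implicit Types x : 'rV[R]_n.

Lemma sqn_ge0 x : 0 <= sqn x.
Proof. by rewrite sqnE sumr_ge0 // => i _; rewrite sqr_ge0. Qed.

Lemma sqn_eq0 x : (sqn x == 0) = (x == 0).
Proof.
apply/eqP/eqP => [|->]; last exact: sqn0.
rewrite sqnE => /psumr_eq0P x0; apply/rowP => i; rewrite mxE; apply/eqP.
by rewrite -sqrf_eq0; apply/eqP/x0 => // j _; rewrite sqr_ge0.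
Qed.

Lemma sqn_gt0 x : (0 < sqn x) = (x != 0).
Proof. by rewrite lt_def sqn_ge0 andbT sqn_eq0. Qed.

End RowDotReal.

Lemma sqn_mulmx_gt0 (R : realFieldType) n (W : 'M[R]_n) (x : 'rV_n) :
  W \in unitmx -> x != 0 -> 0 < sqn (x *m W).
Proof.
move=> Wu; rewrite sqn_gt0; apply: contraNneq => xW0.
by rewrite -(mulmxK Wu x) xW0 mul0mx.
Qed.

(** Induction on the dimension through the Schur complement of the top left entry [a]. It turns a
    positive definite matrix back into a factor, hence into an ellipsoid. *)
Lemma cholesky (R : rcfType) n (S : 'M[R]_n) : S^T = S ->
  (forall x : 'rV_n, x != 0 -> 0 < rdot (x *m S) x) ->
  exists2 V : 'M[R]_n, V \in unitmx & S = V *m V^T.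
Proof.
elim: n S => [|n IHn] S Ssym Spos.
  by exists 1%:M; rewrite ?unitmx1// [LHS]flatmx0 [RHS]flatmx0.
move: S Ssym Spos; rewrite -[n.+1]/(1 + n)%N => S Ssym Spos.
pose a := S (lshift n 0) (lshift n 0); pose b := ursubmx S; pose D := drsubmx S.
have SE : S = block_mx a%:M b b^T D.
  rewrite -[LHS]submxK; congr block_mx; last by rewrite trmx_ursub Ssym.
  by rewrite [LHS]mx11_scalar !mxE.
have DT : D^T = D by rewrite trmx_drsub Ssym.
have a_gt0 : 0 < a.
  have /Spos : row_mx 1%:M 0 != 0 :> 'rV[R]_(1 + n).
    rewrite -row_mx0; apply/eqP => /eq_row_mx[/matrixP/(_ 0 0)].
    by rewrite !mxE eqxx => /eqP; rewrite oner_eq0.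
  rewrite SE /rdot mul_row_block tr_row_mx mul_row_col !mul1mx !mul0mx !addr0.
  by rewrite trmx1 trmx0 mulmx1 mulmx0 addr0 mxE eqxx.
have a0 : a != 0 by rewrite gt_eqF.
have [|y y0|V Vu VE] := IHn (D - a^-1 *: (b^T *m b)).
- by rewrite raddfB/= linearZ/= trmx_mul trmxK DT.
(* For fixed [y] this [c] minimizes the form of [S]; the minimum is the form of the Schur complement
   at [y]. *)
- pose c := - a^-1 *: (y *m b^T).
  have /Spos : row_mx c y != 0.
    by rewrite -row_mx0; apply: contra_neq y0 => /eq_row_mx[].
  rewrite SE /rdot mul_row_block tr_row_mx mul_row_col mul_mx_scalar.
  rewrite /c scalerA mulrN divff// scaleN1r addNr mul0mx add0r.
  by rewrite mulmxBr addrC -scalemxAl -scalemxAr mulmxA scaleNr.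
have sa0 : Num.sqrt a != 0 by rewrite gt_eqF// sqrtr_gt0.
exists (block_mx (Num.sqrt a)%:M 0 ((Num.sqrt a)^-1 *: b^T) V).
  rewrite unitmxE det_lblock unitrM -!unitmxE Vu andbT.
  by rewrite unitmxE det_scalar unitfE expf_neq0.
rewrite tr_block_mx mulmx_block !trmx0 !(mul0mx, mulmx0) !addr0 -VE.
rewrite SE; congr block_mx.
- by rewrite tr_scalar_mx -scalar_mxM -expr2 sqr_sqrtr// ltW.
- by rewrite linearZ /= trmxK mul_scalar_mx scalerA divff// scale1r.
- by rewrite tr_scalar_mx mul_mx_scalar scalerA divff// scale1r.
- rewrite linearZ /= trmxK -scalemxAl -scalemxAr scalerA -invfM -expr2.
  by rewrite sqr_sqrtr ?ltW// addrC subrK.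
Qed.

(** * Ellipsoids as unit balls of quadratic forms *)

Definition ell (R : realType) n (W : 'M[R]_n) : set 'rV[R]_n :=
  [set x | sqn (x *m W) <= 1].

(** The spanning vectors are the rows of [invmx W]: the coefficients of [x] along them form the row
    [x *m W]. *)
Lemma ellipsoidP (R : realType) n (F : set 'rV[R]_n) :
  ellipsoid F <-> exists2 W, W \in unitmx & F = ell W.
Proof.
split=> [[u ufree ->]|[W Wu ->]].
  pose V := \matrix_(i < n) tnth u i.
  have sumE (l : 'I_n -> R) :
      \sum_(i < n) l i *: tnth u i = (\row_i l i) *m V.
    rewrite mulmx_sum_row; apply: eq_bigr => i _.
    by rewrite rowK mxE.
  have Vu : V \in unitmx.
    rewrite -row_free_unit; apply: inj_row_free => v vV0.
    apply/rowP => i; rewrite mxE.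
    move/freeP: ufree => /(_ (fun i => v 0 i)); apply.
    rewrite -[RHS]vV0 mulmx_sum_row; apply: eq_bigr => j _.
    by rewrite rowK (tnth_nth 0).
  exists (invmx V); first by rewrite unitmx_inv.
  apply/seteqP; split=> x /=.
    move=> [l ll <-]; rewrite /ell/= sumE mulmxK// sqnE.
    by under eq_bigr do rewrite mxE.
  rewrite /ell/= sqnE => xV; exists (fun i => (x *m invmx V) 0 i) => //.
  rewrite sumE -[RHS](mulmxKV Vu); congr (_ *m _).
  by apply/rowP => i; rewrite mxE.
have Vu : invmx W \in unitmx by rewrite unitmx_inv.
have sumE (l : 'I_n -> R) :
    \sum_(i < n) l i *: tnth [tuple row i (invmx W) | i < n] i =
    (\row_i l i) *m invmx W.
  rewrite mulmx_sum_row; apply: eq_bigr => i _.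
  by rewrite tnth_mktuple mxE.
exists [tuple row i (invmx W) | i < n].
  apply/freeP => k k0 i.
  have : (\row_i k i) *m invmx W = 0.
    by rewrite -sumE -[RHS]k0; apply: eq_bigr => j _; rewrite (tnth_nth 0).
  move=> /(congr1 (mulmx^~ W)); rewrite mulmxKV// mul0mx.
  by move=> /rowP/(_ i); rewrite !mxE.
apply/seteqP; split=> x /=.
  rewrite /ell/= sqnE => xW; exists (fun i => (x *m W) 0 i) => //.
  rewrite sumE -[RHS](mulmxK Wu); congr (_ *m _).
  by apply/rowP => i; rewrite mxE.
move=> [l ll <-]; rewrite /ell/= sumE mulmxKV// sqnE.
by under eq_bigr do rewrite mxE.
Qed.

Lemma body_norm_ell (R : realType) n (W : 'M[R]_n) (x : 'rV_n) :
  body_norm (ell W) x ^+ 2 = sqn (x *m W).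
Proof.
set q := sqn _; have q0 : 0 <= q := sqn_ge0 _.
suff -> : body_norm (ell W) x = Num.sqrt q by rewrite sqr_sqrtr.
rewrite /body_norm; set S := [set l | _].
have SE l : S l <-> 0 < l /\ Num.sqrt q <= l.
  split=> -[l0 lx]; split=> //.
    case: lx => y /= yW xE.
    rewrite -(ger0_norm (ltW l0)) -sqrtr_sqr ler_sqrt ?sqr_ge0//.
    by rewrite /q -xE -scalemxAl sqnZ ler_piMr// sqr_ge0.
  exists (l^-1 *: x); last by rewrite scalerA divff ?gt_eqF// scale1r.
  rewrite /ell/= -scalemxAl sqnZ exprVn ler_pdivrMl ?exprn_gt0// mulr1.
  by rewrite -/q -(sqr_sqrtr q0) ler_sqr ?nnegrE ?sqrtr_ge0// ltW.
have Slb : lbound S (Num.sqrt q) by move=> l /SE[].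
(* For [x = 0] the infimum is not attained, as [l] must be positive, so it is approached from
   above. *)
have Se e : 0 < e -> S (Num.sqrt q + e).
  by move=> e0; apply/SE; rewrite lerDl ltW// ltr_wpDl ?sqrtr_ge0.
apply/eqP; rewrite eq_le; apply/andP; split.
  apply/ler_addgt0Pr => e e0; apply: ge_inf; last exact: Se.
  by exists (Num.sqrt q).
by apply: lb_le_inf => //; exists (Num.sqrt q + 1); apply: Se.
Qed.

(** Read on the complement of [K], inclusion becomes a family of closed conditions on [W]. *)
Lemma ell_subset (R : realType) n (K : set 'rV[R]_n) (W : 'M[R]_n) :
  closed K ->
  ell W `<=` K <-> forall x, ~ K x -> 1 <= sqn (x *m W).
Proof.
move=> Kcl; split=> [WK x Kx|WK x Wx].
  by rewrite leNgt; apply/negP => /ltW/WK.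
(* A point of [ell W] is a limit of shrunken copies at which the form is strictly below 1; these lie
   in [K], which is closed. *)
have xcvg : (1 - harmonic k) *: x @[k --> \oo] --> x.
  rewrite -[X in _ --> X]scale1r; apply: cvgZr_tmp.
  rewrite -[X in _ --> X](subr0 1); apply: cvgB; first exact: cvg_cst.
  exact: cvg_harmonic.
apply: (closed_cvg _ Kcl _ _ xcvg); apply: nearW => k.
apply: contrapT => /WK; apply/negP; rewrite -ltNge -scalemxAl sqnZ.
apply: (@le_lt_trans _ _ ((1 - harmonic k) ^+ 2)).
  by rewrite ler_piMr// sqr_ge0.
have h0 : 0 < harmonic k :> R by rewrite /harmonic/= invr_gt0.
have h1 : harmonic k <= 1 :> R by rewrite /harmonic/= invf_le1// ler1n.
by nra.
Qed.

(** * Gram matrices and the averaging of two ellipsoids *)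

Lemma sqn_mulmx_tr (R : realType) n (W1 W2 : 'M[R]_n) (x : 'rV_n) :
  W1 *m W1^T = W2 *m W2^T -> sqn (x *m W1) = sqn (x *m W2).
Proof.
move=> WE.
by rewrite /sqn /rdot !trmx_mul -!mulmxA (mulmxA W1) (mulmxA W2) WE.
Qed.

(** Inverse Gram matrices, that is dual forms, are averaged. The last two clauses are the inequality
    between harmonic and arithmetic means, with its equality case. *)
Lemma ell_midpoint (R : realType) n (K : set 'rV[R]_n) (W1 W2 : 'M[R]_n) :
  convex_set K -> W1 \in unitmx -> W2 \in unitmx ->
  ell W1 `<=` K -> ell W2 `<=` K ->
  exists W, [/\ W \in unitmx, ell W `<=` K,
    forall x, sqn (x *m W) *+ 2 <= sqn (x *m W1) + sqn (x *m W2) &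
    forall x, sqn (x *m W) *+ 2 = sqn (x *m W1) + sqn (x *m W2) ->
      x *m (W1 *m W1^T) = x *m (W2 *m W2^T)].
Proof.
move=> Kconv W1u W2u W1K W2K.
pose U1 := (invmx W1)^T; pose U2 := (invmx W2)^T.
have U1u : U1 \in unitmx by rewrite unitmx_tr unitmx_inv.
have U2u : U2 \in unitmx by rewrite unitmx_tr unitmx_inv.
pose S := 2^-1 *: (U1 *m U1^T + U2 *m U2^T).
have xSx x : rdot (x *m S) x = (sqn (x *m U1) + sqn (x *m U2)) / 2.
  rewrite /S -scalemxAr mulmxDr rdotZl rdotDl !mulmxA.
  by rewrite (rdotMl (x *m U1)) (rdotMl (x *m U2)) !trmxK mulrC.
have [||V Vu SE] := @cholesky R n S.
- by rewrite /S linearZ/= raddfD/= !trmx_mul !trmxK.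
- move=> x x0; rewrite xSx divr_gt0// addr_gt0//; exact: sqn_mulmx_gt0.
pose W := (invmx V)^T.
have Wu : W \in unitmx by rewrite unitmx_tr unitmx_inv.
(* Since [W *m W^T] is the inverse of [S], the form of [W] at [x] is the form of [S] at the dual
   vector [xi x]. *)
pose xi (x : 'rV[R]_n) := x *m W *m W^T.
have xE x : x = xi x *m S.
  rewrite /xi SE trmxK mulmxA mulmxKV// /W -mulmxA -trmx_mul mulmxV//.
  by rewrite trmx1 mulmx1.
have xWE x : sqn (x *m W) = (sqn (xi x *m U1) + sqn (xi x *m U2)) / 2.
  by rewrite -xSx -xE rdotC rdotMl trmxK.
(* [U1] is inverse to [W1^T], and [U2] to [W2^T], so both cross products equal [sqn (x *m W)] and
   the defect is a sum of two squares. *)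
have gap x : sqn (x *m W1) + sqn (x *m W2) - sqn (x *m W) *+ 2 =
    sqn (x *m W1 - xi x *m U1) + sqn (x *m W2 - xi x *m U2).
  have rW1 : rdot (x *m W1) (xi x *m U1) = sqn (x *m W).
    by rewrite rdotC rdotMl trmxK mulmxK// rdotMl trmxK.
  have rW2 : rdot (x *m W2) (xi x *m U2) = sqn (x *m W).
    by rewrite rdotC rdotMl trmxK mulmxK// rdotMl trmxK.
  by rewrite !sqnB rW1 rW2 xWE; field.
exists W; split=> //.
- move=> x; rewrite /ell/= xWE => xW.
  (* The case [x = 0] is set apart because [a] and [2 - a] are inverted below. *)
  have [xi0|xi0] := eqVneq (xi x) 0.
    by apply: W1K; rewrite /ell/= (xE x) xi0 !mul0mx sqn0.
  have a0 : 0 < sqn (xi x *m U1) by exact: sqn_mulmx_gt0.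
  have b0 : 0 < sqn (xi x *m U2) by exact: sqn_mulmx_gt0.
  (* [x = (y1 + y2) / 2] with [yi = xi x *m Ui *m Ui^T], whose [Wi]-norms [a]
     and [b] satisfy [a ^+ 2 + b ^+ 2 <= 2], hence [b <= 2 - a]: the weights
     [a / 2] and [1 - a / 2] rescale [y1] and [y2] into the two ellipsoids. *)
  set a := Num.sqrt (sqn (xi x *m U1)); set b := Num.sqrt (sqn (xi x *m U2)).
  have aE : a ^+ 2 = sqn (xi x *m U1) by rewrite sqr_sqrtr// ltW.
  have bE : b ^+ 2 = sqn (xi x *m U2) by rewrite sqr_sqrtr// ltW.
  have {}a0 : 0 < a by rewrite sqrtr_gt0.
  have {}b0 : 0 < b by rewrite sqrtr_gt0.
  rewrite -aE -bE in xW.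
  have ab : a + b <= 2 by have := sqr_ge0 (a - 1); have := sqr_ge0 (b - 1); lra.
  have l0 : 0 <= a / 2 by rewrite divr_ge0// ltW.
  have l1 : a / 2 <= 1 by lra.
  pose l : {i01 R} := Itv01 l0 l1.
  have K1 : K (a^-1 *: (xi x *m U1 *m U1^T)).
    apply: W1K; rewrite /ell/= -scalemxAl sqnZ /U1 trmxK mulmxKV// -/U1 -aE.
    by rewrite exprVn mulVf// gt_eqF// exprn_gt0.
  have K2 : K ((2 - a)^-1 *: (xi x *m U2 *m U2^T)).
    apply: W2K; rewrite /ell/= -scalemxAl sqnZ /U2 trmxK mulmxKV// -/U2 -bE.
    rewrite exprVn ler_pdivrMl ?mulr1 ?exprn_gt0//; last by lra.
    by rewrite ler_sqr ?nnegrE; lra.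
  have := Kconv _ _ l (mem_set K1) (mem_set K2).
  rewrite inE; congr (K _); rewrite /conv/= /unstable.onem !scalerA.
  rewrite {3}(xE x) /S -scalemxAr mulmxDr !mulmxA scalerDr.
  by congr (_ *: _ + _ *: _); field; rewrite ?gt_eqF//; lra.
- by move=> x; rewrite -subr_ge0 gap addr_ge0// sqn_ge0.
move=> x eqx.
(* Both squares vanish, so [x *m W1 *m W1^T] and [x *m W2 *m W2^T] are both [xi x]. *)
have /eqP : sqn (x *m W1 - xi x *m U1) + sqn (x *m W2 - xi x *m U2) = 0.
  by rewrite -gap eqx subrr.
rewrite paddr_eq0 ?sqn_ge0// !sqn_eq0 !subr_eq0 => /andP[/eqP x1 /eqP x2].
by rewrite !mulmxA x1 x2 /U1 /U2 -!mulmxA -!trmx_mul !mulmxV// !trmx1.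
Qed.

(** * Existence of a minimizer by compactness *)

Lemma sum_continuous (R : realType) (T : topologicalType) (I : finType)
    (F : I -> T -> R) :
  (forall i, continuous (F i)) -> continuous (fun x => \sum_i F i x).
Proof.
move=> Fc; have := @continuous_big R I +%R 0 xpredT (@add_continuous R^o) T
  (index_enum I) F (fun i _ => Fc i).
exact.
Qed.

Lemma linear_coord_continuous (R : realType) p n
    (f : {linear 'rV[R]_p -> 'rV[R]_n}) (j : 'I_n) :
  continuous (fun x => f x 0 j).
Proof.
have -> : (fun x => f x 0 j) =
    (fun x : 'rV[R]_p => \sum_i x 0 i * f (delta_mx 0 i) 0 j).
  apply/funext => x; rewrite {1}(row_sum_delta x) linear_sum summxE.
  by apply: eq_bigr => i _; rewrite linearZ mxE.
apply: sum_continuous => i x.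
by apply: continuousM; [exact: coord_continuous|exact: cst_continuous].
Qed.

Lemma linear_sqn_continuous (R : realType) p n
    (f : {linear 'rV[R]_p -> 'rV[R]_n}) :
  continuous (fun x => sqn (f x)).
Proof.
have -> : (fun x => sqn (f x)) = (fun x => \sum_i f x 0 i * f x 0 i).
  by apply/funext => x; rewrite /sqn rdotE.
apply: sum_continuous => i x.
by apply: continuousM; exact: linear_coord_continuous.
Qed.

(** Summed by rows because the rows of [invmx A] are orthonormal for [ell A]: [frob (invmx A *m W)]
    adds up the form of [W] over that basis. *)
Definition frob (R : pzRingType) m n (B : 'M[R]_(m, n)) : R :=
  \sum_i sqn (row i B).

Lemma frob_trmx (R : comPzRingType) m n (B : 'M[R]_(m, n)) :
  frob B^T = frob B.
Proof.
rewrite /frob; under eq_bigr do rewrite sqnE.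
rewrite exchange_big; apply: eq_bigr => i _; rewrite sqnE.
by apply: eq_bigr => j _; rewrite !mxE.
Qed.

Lemma ell_minimizer (R : realType) n (K : set 'rV[R]_n) (A : 'M[R]_n) :
  closed K -> bounded_set K -> A \in unitmx ->
  (exists2 W : 'M[R]_n, W \in unitmx & ell W `<=` K) ->
  exists W : 'M[R]_n, [/\ W \in unitmx, ell W `<=` K &
    forall W' : 'M[R]_n, W' \in unitmx -> ell W' `<=` K ->
      frob (invmx A *m W) <= frob (invmx A *m W')].
Proof.
move=> Kcl Kbd Au [W0 W0u W0K].
(* The unknown is [invmx A *m W], flattened to a row [b], so that the objective is [frob] itself. *)
pose f (b : 'rV[R]_(n * n)) := frob (vec_mx b).
pose g (x : 'rV[R]_n) (b : 'rV[R]_(n * n)) := sqn (x *m (A *m vec_mx b)).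
have fcont : continuous f.
  apply: sum_continuous => i.
  exact: (@linear_sqn_continuous R (n * n) n (@row _ _ _ i \o vec_mx)).
have gcont x : continuous (g x).
  exact: (@linear_sqn_continuous R (n * n) n
    (mulmx x \o (@mulmx _ n n n A \o vec_mx))).
pose C := frob (invmx A *m W0).
pose Z := \bigcap_(x in ~` K) (g x @^-1` [set t | 1 <= t]) `&`
          f @^-1` [set t | t <= C].
have Zcompact : compact Z.
  (* An entry whose square is at most [C] has absolute value at most [C + 1]. *)
  pose Q := [set b : 'rV[R]_(n * n) |
    forall k, `[- (C + 1), C + 1]%classic (b 0 k)].
  apply: (@subclosed_compact _ _ Q).
  - apply: closedI; last by apply: closed_comp => //; exact: closed_le.
    by apply: closed_bigI => x _; apply: closed_comp => //; exact: closed_ge.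
  - apply: (@rV_compact _ _ (fun=> `[- (C + 1), C + 1]%classic)) => _.
    exact: segment_compact.
  move=> b [_ /= fb] k; case/mxvec_indexP: k => i j.
  have bE : b 0 (mxvec_index i j) = row i (vec_mx b) 0 j.
    by rewrite !mxE.
  have bC : b 0 (mxvec_index i j) ^+ 2 <= C.
    apply: le_trans fb; rewrite bE /f /frob (bigD1 i)//= {1}/sqn rdotE.
    rewrite (bigD1 j)//=.
    rewrite -expr2 -addrA lerDl addr_ge0 ?sumr_ge0// => l _.
      by rewrite -expr2 sqr_ge0.
    exact: sqn_ge0.
  rewrite /= in_itv/=; apply/andP; split; nra.
have ZP W : W \in unitmx -> ell W `<=` K -> frob (invmx A *m W) <= C ->
    Z (mxvec (invmx A *m W)).
  move=> Wu WK WC; split; last by rewrite /= /f mxvecK.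
  move=> x Kx; rewrite /= /g mxvecK mulKVmx//.
  by move: x Kx; apply/ell_subset.
have [|b /set_mem[bK bC] bmin] := compact_EVT_min _ Zcompact
    (continuous_subspaceT fcont).
  by exists (mxvec (invmx A *m W0)); apply: ZP.
have bE x : ~ K x -> 1 <= sqn (x *m (A *m vec_mx b)) by move=> /bK.
exists (A *m vec_mx b); split.
(* A nonzero kernel vector could be scaled out of the bounded set [K] while its form stays 0,
   against [bE]. *)
- rewrite -row_free_unit; apply: inj_row_free => x x0.
  apply: contrapT => /eqP xn0.
  case: Kbd => M [Mreal KM].
  have nx0 : 0 < `|x| by rewrite normr_gt0.
  pose t := (`|M| + 2) / `|x|.
  have /bE : ~ K (t *: x).
    have MM : M < `|M| + 1 by rewrite (le_lt_trans (ler_norm M))// ltrDl.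
    move=> /(KM _ MM) /=; rewrite normrZ /t normrM normfV normr_id.
    rewrite divfK ?gt_eqF// ger0_norm ?addr_ge0// lerD2l.
    by rewrite (ler_nat _ 2 1).
  by rewrite -scalemxAl x0 scaler0 sqn0 ler10.
- exact/ell_subset.
move=> W' W'u W'K; rewrite mulKmx//.
have [W'C|/ltW CW'] := leP (frob (invmx A *m W')) C.
  have /mem_set/bmin := ZP _ W'u W'K W'C.
  by rewrite /f mxvecK.
exact: le_trans CW'.
Qed.

(** For [x0] interior, a point [y] near 0 is the midpoint of [x0 + 2 *: y] and [- x0]; both lie in
    [K], the second by symmetry. *)
Lemma body_contains_ell (R : realType) n (K : set 'rV[R]_n) :
  body K -> exists2 W : 'M[R]_n, W \in unitmx & ell W `<=` K.
Proof.
move=> [_ Kconv Ksym [x0 /nbhs_ballP[e /= e0 eK]]].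
(* The factor 4 bounds the coordinates of [y] by [e / 4], which keeps [x0 + 2 *: y] within [e / 2]
   of [x0]. *)
pose c := 4 / e; have c0 : 0 < c by rewrite divr_gt0.
exists c%:M.
  by rewrite unitmxE det_scalar unitfE expf_neq0// gt_eqF.
move=> y; rewrite /ell/= mul_mx_scalar sqnZ => yc.
have h0 : 0 <= 2^-1 :> R by rewrite invr_ge0.
have h1 : 2^-1 <= 1 :> R by rewrite invf_le1// ler1n.
have Kx : K (x0 + 2 *: y).
  apply: eK; split=> // i j; rewrite (ord1 i) /ball/= !mxE opprD addNKr normrN.
  have yj : (c * y 0 j) ^+ 2 <= 1.
    apply: le_trans yc; rewrite exprMn sqnE (bigD1 j)//= ler_wpM2l ?sqr_ge0//.
    by rewrite lerDl sumr_ge0// => k _; rewrite sqr_ge0.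
  have yj' : `|y 0 j| <= e / 4.
    rewrite -(ler_pM2l c0) {2}/c mulrA divfK ?gt_eqF// divff//.
    rewrite -(@ler_sqr _ (_ * _)) ?nnegrE ?mulr_ge0 ?invr_ge0 ?(ltW e0)//.
    by rewrite exprMn real_normK ?num_real// expr1n -exprMn.
  rewrite normrM ger0_norm//.
  by rewrite (le_lt_trans (ler_wpM2l _ yj'))//; lra.
have KNx : K (- x0).
  by rewrite Ksym; exists x0 => //; apply: eK; exact: ballxx.
have := Kconv _ _ (Itv01 h0 h1) (mem_set Kx) (mem_set KNx).
rewrite inE; congr (K _); rewrite /conv/= /unstable.onem.
rewrite scalerDr scalerA mulVf// scale1r.
have -> : 1 - 2^-1 = 2^-1 :> R by field.
by rewrite scalerN addrAC subrr add0r.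
Qed.

(** * The scalar product of the ellipsoid and the second moments of the invariant measure *)

Lemma scalar_product_of_ell (R : realType) n (A : 'M[R]_n)
    (s : {dot 'rV[R]_n for idfun}) :
  scalar_product_of (ell A) s ->
  A \in unitmx ->
  forall x y, s x y = rdot (x *m A) (y *m A).
Proof.
move=> sE Au.
have sC x y : s x y = s y x by rewrite hermC expr0 mul1r.
have sZ (c : R) x : s (c *: x) (c *: x) = c ^+ 2 * s x x.
  by rewrite linearZl_LR/= linearZr_LR/= mulrA expr2.
have sle x : (s x x <= 1) = (sqn (x *m A) <= 1).
  by apply/idP/idP; move: (congr1 (fun S => S x) sE); rewrite /ell/= => ->.
have sq x : s x x = sqn (x *m A).
  have [->|x0] := eqVneq x 0; first by rewrite linear0l mul0mx sqn0.
  have q0 : 0 < sqn (x *m A) by exact: sqn_mulmx_gt0.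
  have s0 : 0 < s x x by exact: neq0_dnorm_gt0.
  (* Both forms are homogeneous of degree 2, so equal unit balls force equal values: each is tested
     at [x] normalized for the other. Polarization then gives the products. *)
  have scale (c : R) : (c ^+ 2 * s x x <= 1) = (c ^+ 2 * sqn (x *m A) <= 1).
    by rewrite -sZ sle -scalemxAl sqnZ.
  apply/eqP; rewrite eq_le; apply/andP; split.
    have := scale (Num.sqrt (sqn (x *m A)))^-1.
    rewrite exprVn sqr_sqrtr ?(ltW q0)// mulVf ?gt_eqF// lexx.
    by rewrite ler_pdivrMl// mulr1.
  have := scale (Num.sqrt (s x x))^-1.
  rewrite exprVn sqr_sqrtr ?(ltW s0)// mulVf ?gt_eqF// lexx.
  by move/esym; rewrite ler_pdivrMl// mulr1.
move=> x y; have := sq (x + y).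
have -> : s (x + y) (x + y) = s x x + s y y + 2 * s x y.
  rewrite linearDl/= !linearDr/= [s y x]sC; ring.
have -> : sqn ((x + y) *m A) =
    sqn (x *m A) + sqn (y *m A) + 2 * rdot (x *m A) (y *m A).
  rewrite mulmxDl /sqn rdotDl !(rdotC _ (_ + _)) !rdotDl (rdotC (y *m A)).
  by ring.
rewrite !sq; lra.
Qed.

Lemma continuous_borel_measurable (R : realType) n (f : 'rV[R]_n -> R) :
  continuous f -> measurable_fun [set: borelRV R n] (f : borelRV R n -> R).
Proof.
move=> fc; apply: (measurability _ (RGenOInfty.measurableE R)).
move=> _ [_ [a ->] <-]; rewrite setTI; apply: sub_sigma_algebra.
rewrite set_itvoy; move/continuousP: fc; apply; exact: open_gt.
Qed.

Lemma continuous_borel_measurable_rV (R : realType) n m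
    (f : 'rV[R]_n -> 'rV[R]_m) :
  continuous f ->
  measurable_fun [set: borelRV R n] (f : borelRV R n -> borelRV R m).
Proof.
move=> fc; apply: (@measurability _ _ (borelRV R n) (borelRV R m) setT f
  (@open 'rV[R]_m)) => //.
move=> _ [U oU <-]; rewrite setTI; apply: sub_sigma_algebra.
by move/continuousP: fc; apply.
Qed.

Lemma linear_rV_continuous (R : realType) n m
    (f : {linear 'rV[R]_n -> 'rV[R]_m}) : continuous f.
Proof.
move=> x.
apply/(@cvg_ballP _ 'rV[R]_m _ (nbhs x) (nbhs_filter x) f (f x)) => e e0.
have : \forall y \near x, forall j, ball (f x 0 j) e (f y 0 j).
  apply: (@filter_forall _ _ (fun j y => ball (f x 0 j) e (f y 0 j)) (nbhs x)
    (nbhs_filter x)) => j.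
  have cj : f y 0 j @[y --> x] --> f x 0 j by exact: linear_coord_continuous.
  exact: (@cvg_ball _ _ _ (nbhs x) (nbhs_filter x) (fun y => f y 0 j) _
    cj e e0).
apply: filterS => y fy; split=> // i j; rewrite (ord1 i); exact: fy.
Qed.

Lemma ell_closed (R : realType) n (A : 'M[R]_n) : closed (ell A).
Proof.
have -> : ell A = (fun x => sqn (mulmxr A x)) @^-1` [set t | t <= 1] by [].
apply: closed_comp; last exact: closed_le.
by move=> x _; exact: linear_sqn_continuous.
Qed.

Lemma ell_boundary (R : realType) n (A : 'M[R]_n) :
  boundary (ell A) `<=` [set x | sqn (x *m A) = 1].
Proof.
move=> x [] /ell_closed; rewrite /ell/= => xA1 xint.
apply/eqP; rewrite eq_le xA1/= leNgt; apply/negP => xA.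
have oU : open ((fun x => sqn (mulmxr A x)) @^-1` [set t | t < 1]).
  apply: open_comp; last exact: open_lt.
  by move=> y _; exact: linear_sqn_continuous.
apply: xint; apply: filterS (open_nbhs_nbhs (conj oU xA)).
by move=> y /= /ltW.
Qed.

Lemma borel_boundary (R : realType) n (E : set 'rV[R]_n) :
  measurable (boundary E : set (borelRV R n)).
Proof.
apply: measurableD; last first.
  by apply: sub_sigma_algebra; exact: open_interior.
rewrite -(setCK (closure E)); apply: measurableC; apply: sub_sigma_algebra.
exact/closed_openC/closed_closure.
Qed.

(** The boundary has full mass, so both integrals extend to the whole space, where the push-forward
    of [mu] along [T] is [mu] itself. *)
Lemma invariant_integral (R : realType) n (E : set 'rV[R]_n)
    (s : {dot 'rV[R]_n for idfun}) (mu : probability (borelRV R n) R)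
    (T : {linear 'rV[R]_n -> 'rV[R]_n}) (f : 'rV[R]_n -> R) :
  invariant_probability E s mu -> isometry s s T ->
  continuous f -> (forall x, 0 <= f x) ->
  (\int[mu]_(x in boundary E) (f (T x))%:E =
   \int[mu]_(x in boundary E) (f x)%:E)%E.
Proof.
move=> [mu1 muT] Tiso fc f0.
pose B := boundary E : set (borelRV R n).
have mB : measurable B by exact: borel_boundary.
have muB : mu (~` B) = 0%E by rewrite probability_setC// [mu B]mu1 subee.
have full (g : 'rV[R]_n -> R) : continuous g -> (forall x, 0 <= g x) ->
    (\int[mu]_(x in B) (g x)%:E = \int[mu]_x (g x)%:E)%E.
  move=> gc g0; rewrite [RHS](@ge0_negligible_integral _ _ _ _ _ (~` B))//.
  - by rewrite setDE setCK setTI.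
  - exact: measurableC.
  - by apply/measurable_EFinP; exact: continuous_borel_measurable.
  - by move=> x _; rewrite lee_fin.
have Tc : continuous T by exact: linear_rV_continuous.
have fTc : continuous (f \o T).
  by move=> x; apply: continuous_comp; [exact: Tc|exact: fc].
have mT : measurable_fun [set: borelRV R n] (T : borelRV R n -> borelRV R n).
  exact: continuous_borel_measurable_rV.
have mf : measurable_fun [set: borelRV R n] (EFin \o f).
  by apply/measurable_EFinP; exact: continuous_borel_measurable.
rewrite (full _ fTc (fun x => f0 (T x))) (full _ fc)//.
rewrite -[RHS](@eq_measure_integral _ _ _ _ _
  (pushforward mu (T : borelRV R n -> borelRV R n))); last first.
  by move=> A mA _; rewrite /pushforward; exact: muT.
rewrite (@ge0_integral_pushforward _ _ _ _ _ _ mT)//.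
by move=> x _; rewrite lee_fin.
Qed.

(** Householder reflection along [u = v - w]: equal lengths give [sqn u = 2 * rdot v u], so it moves
    [v] to [v - u = w]. *)
Lemma exists_reflection (R : realFieldType) n (v w : 'rV[R]_n) :
  sqn v = sqn w -> exists2 O : 'M[R]_n, O *m O^T = 1%:M & v *m O = w.
Proof.
move=> vw; have [<-|neq_vw] := eqVneq v w.
  by exists 1%:M; rewrite ?trmx1 mulmx1.
pose u := v - w; pose c := 2 / sqn u.
have u0 : sqn u != 0 by rewrite sqn_eq0 subr_eq0.
have uE : sqn u = 2 * rdot v u.
  rewrite [rdot v u]rdotC rdotDl -scaleN1r rdotZl /u sqnB -vw.
  by rewrite -/(sqn v) (rdotC w); ring.
have uuT : u *m u^T = (sqn u)%:M by rewrite [LHS]mx11_scalar.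
have vuT : v *m u^T = (rdot v u)%:M by rewrite [LHS]mx11_scalar.
have vu : v - u = w by rewrite /u opprB addrC subrK.
clearbody u; exists (1%:M - c *: (u^T *m u)).
  have -> : (1%:M - c *: (u^T *m u))^T = 1%:M - c *: (u^T *m u).
    by rewrite raddfB/= trmx1 linearZ/= trmx_mul trmxK.
  rewrite mulmxBl mul1mx mulmxBr mulmx1 -scalemxAl -scalemxAr scalerA.
  rewrite -mulmxA (mulmxA u) uuT mul_scalar_mx -scalemxAr scalerA.
  have -> : c * c * sqn u = 2 * c by rewrite /c; field.
  rewrite mulr_natl mulr2n scalerDl; set Y := c *: _.
  have -> : Y - (Y + Y) = - Y by rewrite opprD addrA subrr add0r.
  by rewrite opprK subrK.
rewrite mulmxBr mulmx1 -scalemxAr mulmxA vuT mul_scalar_mx scalerA.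
have r0 : rdot v u != 0 by apply: contraNneq u0 => r0; rewrite uE r0 mulr0.
have -> : c * rdot v u = 1 by rewrite /c uE; field.
by rewrite scale1r.
Qed.

Lemma rdot_sqr_continuous (R : realType) n (A : 'M[R]_n) (w : 'rV_n) :
  continuous (fun x : 'rV[R]_n => rdot (x *m A) w ^+ 2).
Proof.
have -> : (fun x : 'rV[R]_n => rdot (x *m A) w ^+ 2) =
    (fun x => sqn (mulmxr (A *m w^T) x)).
  by apply/funext => x; rewrite sqnE big_ord1/= mulmxA.
exact: linear_sqn_continuous.
Qed.

(** By invariance the moment depends only on the length of [v], and it is quadratic in it. Over the
    standard basis the moments add up to 1, since [sqn (x *m A) = 1] on the boundary. *)
Lemma second_moment (R : realType) n (A : 'M[R]_n)
    (s : {dot 'rV[R]_n for idfun}) (mu : probability (borelRV R n) R)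
    (v : 'rV[R]_n) :
  A \in unitmx -> scalar_product_of (ell A) s ->
  invariant_probability (ell A) s mu ->
  (\int[mu]_(x in boundary (ell A)) (rdot (x *m A) v ^+ 2)%:E =
   (sqn v / n%:R)%:E)%E.
Proof.
move=> Au sE muE; pose B := boundary (ell A) : set (borelRV R n).
have mB : measurable B by exact: borel_boundary.
pose m (w : 'rV[R]_n) := (\int[mu]_(x in B) (rdot (x *m A) w ^+ 2)%:E)%E.
have mf w : measurable_fun B (fun x => (rdot (x *m A) w ^+ 2)%:E).
  apply: measurable_funTS; apply/measurable_EFinP.
  exact: continuous_borel_measurable (@rdot_sqr_continuous _ _ A w).
have m_ge0 w : (0 <= m w)%E.
  by apply: integral_ge0 => x _; rewrite lee_fin sqr_ge0.
have m_eq w1 w2 : sqn w1 = sqn w2 -> m w1 = m w2.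
  move=> /exists_reflection[Q QQ wQ].
  have sM := scalar_product_of_ell sE Au.
  (* In the coordinates [x *m A] this map is the orthogonal matrix [Q^T]. *)
  have Tiso : isometry s s (mulmxr (A *m Q^T *m invmx A)).
    move=> x y; transitivity (s (x *m (A *m Q^T *m invmx A))
      (y *m (A *m Q^T *m invmx A))) => //.
    rewrite [LHS]sM [RHS]sM !mulmxA !mulmxKV// rdotMl trmxK -(mulmxA _ Q^T).
    by rewrite (mulmx1C QQ) mulmx1.
  rewrite /m.
  rewrite -(invariant_integral muE Tiso (@rdot_sqr_continuous _ _ A w1)).
  2: by move=> x; rewrite sqr_ge0.
  apply: eq_integral => x _; congr (EFin (_ ^+ 2)).
  by rewrite /= !mulmxA mulmxKV// rdotMl trmxK -wQ.
have mZ (c : R) w : m (c *: w) = ((c ^+ 2)%:E * m w)%E.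
  rewrite /m -ge0_integralZl//.
  - apply: eq_integral => x _; rewrite -EFinM; congr EFin.
    by rewrite rdotC rdotZl rdotC exprMn.
  - by move=> x _; rewrite lee_fin sqr_ge0.
  - by rewrite lee_fin sqr_ge0.
pose e (i : 'I_n) : 'rV[R]_n := delta_mx 0 i.
have rdote (x : 'rV[R]_n) i : rdot x (e i) = x 0 i.
  rewrite rdotE (bigD1 i)//= big1 => [|j ji]; rewrite !mxE !eqxx/=.
    by rewrite mulr1 addr0.
  by rewrite (negbTE ji) mulr0.
have sqne i : sqn (e i) = 1 by rewrite /sqn rdote mxE !eqxx.
have sum_me : (\sum_i m (e i) = 1)%E.
  rewrite -ge0_integral_sum//; last first.
    by move=> i x _; rewrite lee_fin sqr_ge0.
  transitivity (\int[mu]_(x in B) (cst 1%E) x)%E.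
    apply: eq_integral => x /set_mem/ell_boundary/= <-.
    rewrite sumEFin sqnE; congr EFin; apply: eq_bigr => i _.
    by rewrite rdote.
  by rewrite integral_cst// mul1e; case: muE.
(* In dimension 0 the empty sum would equal 1, a contradiction. Otherwise the basis vectors share
   the total 1 equally. *)
case: n => [|n] in
  A s mu v Au sE muE B mB m mf m_ge0 m_eq mZ e rdote sqne sum_me *.
  by move: sum_me; rewrite big_ord0 => /eqP; rewrite eqe eq_sym oner_eq0.
have me i : m (e i) = m (e 0) by apply: m_eq; rewrite !sqne.
have m_fin : m (e 0) \is a fin_num.
  rewrite ge0_fin_numE// (@le_lt_trans _ _ 1%E) ?ltry// -sum_me.
  by rewrite big_ord_recl leeDl// sume_ge0.
have me0 : m (e 0) = (n.+1%:R^-1)%:E.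
  move: sum_me; rewrite (eq_bigr (fun=> (fine (m (e 0)))%:E)); last first.
    by move=> i _; rewrite fineK.
  rewrite sumEFin sumr_const card_ord => -[] me1.
  rewrite -(fineK m_fin); congr EFin.
  apply: (@mulfI _ n.+1%:R); first by rewrite pnatr_eq0.
  by rewrite divff ?pnatr_eq0// mulr_natl.
rewrite -/(m v) (m_eq _ (Num.sqrt (sqn v) *: e 0)).
  by rewrite mZ me0 sqr_sqrtr ?sqn_ge0.
by rewrite sqnZ sqne mulr1 sqr_sqrtr ?sqn_ge0.
Qed.

(** The coordinates of [x *m W] are the products of [x *m A] with the columns of [invmx A *m W], and
    their squares integrate by [second_moment]. *)
Lemma M_ell (R : realType) n (A W : 'M[R]_n)
    (s : {dot 'rV[R]_n for idfun}) (mu : probability (borelRV R n) R) :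
  A \in unitmx -> scalar_product_of (ell A) s ->
  invariant_probability (ell A) s mu ->
  M_ (ell A) mu (ell W) = Num.sqrt (frob (invmx A *m W) / n%:R).
Proof.
move=> Au sE muE; congr Num.sqrt; rewrite /Rintegral.
pose v k : 'rV[R]_n := row k (invmx A *m W)^T.
have -> : (\int[mu]_(x in boundary (ell A)) (body_norm (ell W) x ^+ 2)%:E =
    \int[mu]_(x in boundary (ell A))
      (\sum_k (rdot (x *m A) (v k) ^+ 2)%:E))%E.
  apply: eq_integral => x _; rewrite body_norm_ell sqnE sumEFin.
  congr EFin; apply: eq_bigr => k _; congr (_ ^+ 2).
  rewrite /v /rdot tr_row trmxK colE !mulmxA mulmxK// -colE.
  by rewrite [RHS]mxE.
rewrite ge0_integral_sum//; last 3 first.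
- exact: borel_boundary.
- move=> k; apply: measurable_funTS; apply/measurable_EFinP.
  apply: continuous_borel_measurable.
  exact: rdot_sqr_continuous.
- by move=> k x _; rewrite lee_fin sqr_ge0.
under eq_bigr do rewrite (second_moment _ Au sE muE).
by rewrite sumEFin/= -mulr_suml -frob_trmx.
Qed.

(** * Existence and uniqueness of the minimal ellipsoid *)

Theorem mainTheorem1 (R : realType) (n : nat) (K E : set 'rV[R]_n)
    (s : {dot 'rV[R]_n for idfun}) (mu : probability (borelRV R n) R)
    (hK : body K) (hE : ellipsoid E) (hs : scalar_product_of E s)
    (hmu : invariant_probability E s mu) :
  exists! F0 : set 'rV[R]_n,
    [/\ ellipsoid F0, F0 `<=` K &
        M_ E mu F0 =
        inf [set M_ E mu F | F in [set F | ellipsoid F /\ F `<=` K]]].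
Proof.
have [A Au EA] := (ellipsoidP E).1 hE.
rewrite EA in hs hmu *.
have [Kcompact Kconv _ _] := hK.
have Kcl : closed K by apply: compact_closed Kcompact; exact: norm_hausdorff.
have [W0 [W0u W0K W0min]] :=
  ell_minimizer Kcl (compact_bounded Kcompact) Au (body_contains_ell hK).
have ME W : M_ (ell A) mu (ell W) = Num.sqrt (frob (invmx A *m W) / n%:R).
  exact: M_ell Au hs hmu.
set inf_M := inf _.
have infE : inf_M = M_ (ell A) mu (ell W0).
  have W0in : [set M_ (ell A) mu F | F in [set F | ellipsoid F /\ F `<=` K]]
      (M_ (ell A) mu (ell W0)).
    by exists (ell W0) => //; split=> //; apply/ellipsoidP; exists W0.
  have W0lb : lbound [set M_ (ell A) mu F |
      F in [set F | ellipsoid F /\ F `<=` K]] (M_ (ell A) mu (ell W0)).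
    move=> _ [F [/ellipsoidP[W Wu ->] WK] <-].
    by rewrite !ME ler_wsqrtr// ler_wpM2r ?invr_ge0// W0min.
  apply/eqP; rewrite eq_le ge_inf//=; last by eexists; exact: W0lb.
  by apply: lb_le_inf => //; eexists; exact: W0in.
exists (ell W0); split.
  by split=> //; apply/ellipsoidP; exists W0.
move=> F [/ellipsoidP[W Wu ->] WK]; rewrite infE !ME => Mmin.
have frob_ge0 (B : 'M[R]_n) : 0 <= frob B.
  by rewrite sumr_ge0// => i _; rewrite sqn_ge0.
have W0W : frob (invmx A *m W) = frob (invmx A *m W0).
  have [n0|n_gt0] := posnP n.
    by rewrite /frob !big1// => i; have := ltn_ord i; rewrite {2}n0.
  move/eqP: Mmin; rewrite eqr_sqrt ?divr_ge0// => /eqP.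
  by apply: mulIf; rewrite invr_eq0 pnatr_eq0 -lt0n.
have [V [Vu VK Vle Veq]] := ell_midpoint Kconv W0u Wu W0K WK.
have frobE (B : 'M[R]_n) :
    frob (invmx A *m B) = \sum_i sqn (row i (invmx A) *m B).
  by apply: eq_bigr => i _; rewrite row_mul.
have gap_ge0 i : 0 <= sqn (row i (invmx A) *m W0) +
    sqn (row i (invmx A) *m W) - sqn (row i (invmx A) *m V) *+ 2.
  by rewrite subr_ge0.
(* The gaps are nonnegative, yet they sum to twice [frob (invmx A *m W0) - frob (invmx A *m V)],
   which is at most 0 by minimality of [W0]. *)
have gap0 : \sum_i (sqn (row i (invmx A) *m W0) +
    sqn (row i (invmx A) *m W) - sqn (row i (invmx A) *m V) *+ 2) = 0.
  apply/eqP; rewrite eq_le sumr_ge0 ?andbT//.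
  rewrite sumrB big_split/= sumrMnl -!frobE W0W -mulr2n subr_le0.
  by rewrite lerMn2r/= W0min.
(* Every gap vanishes, so the Gram matrices agree on the rows of [invmx A], which form a basis. *)
have WW : W0 *m W0^T = W *m W^T.
  apply: (can_inj (mulKmx (_ : invmx A \in unitmx))); rewrite ?unitmx_inv//.
  apply/row_matrixP => i; rewrite !row_mul; apply: Veq; apply/eqP.
  rewrite eq_sym -subr_eq0; apply/eqP.
  by move/psumr_eq0P : gap0 => /(_ (fun i _ => gap_ge0 i)); apply.
by apply/seteqP; split=> x; rewrite /ell/= (sqn_mulmx_tr _ WW).
Qed.
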